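(* Let $G$ be a $k$-regular graph with $k>0$ and adjacency matrix $A$, and let $\Gamma$ be a finite abelian group with invariant factor decomposition $\Gamma\cong \mathbb Z/d_1\mathbb Z\oplus\cdots\oplus\mathbb Z/d_r\mathbb Z$, $d_1\mid\cdots\mid d_r$. Put $B_\Gamma=\bigoplus_{i=1}^{r-1}\mathbb Z/d_i\mathbb Z$, with $B_\Gamma=\{0\}$ when $r=1$. Assume that the reduced adjacency operator $\overline A$ is nonsingular over $\mathbb Q$. Then the following hold. (a) $G$ admits a generating $\Gamma$-magic map if and only if $B_\Gamma\hookrightarrow \mathsf S_{\mathrm{red}}(G)$. If $r\ge2$ and $G$ admits a generating $\Gamma$-magic map, then necessarily $$d_{r-1}\mid\exp(\mathsf S_{\mathrm{red}}(G))\qquad\text{and}\qquad \frac{|\Gamma|}{d_r}\;\Big|\;\frac{|\det A|}{k}.$$ (b) $G$ admits an affinely generating $\Gamma$-magic map if and only if $\Gamma\hookrightarrow\mathsf S_{\mathrm{red}}(G)$. Consequently, if $G$ admits an affinely generating $\Gamma$-magic map, then $$d_r\mid\exp(\mathsf S_{\mathrm{red}}(G))\qquad\text{and}\qquad |\Gamma|\;\Big|\;\frac{|\det A|}{k}.$$ (c) In particular, if $|V(G)|=|\Gamma|$ and $G$ admits a $\Gamma$-distance magic labeling, then the necessary conditions in (b) hold, namely $\Gamma\hookrightarrow\mathsf S_{\mathrm{red}}(G)$, $d_r\mid\exp(\mathsf S_{\mathrm{red}}(G))$ and $|\Gamma|$ divides $|\det A|/k$.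
   Context: Graphs are finite, simple, undirected, with nonempty vertex set; abelian groups are written additively. In an invariant factor decomposition $r\ge1$ and all $d_i>1$, except that the trivial group has $r=1$, $d_1=1$. $\exp(H)$ is the exponent of a finite abelian group $H$. $H\hookrightarrow K$ means that there exists an injective group homomorphism $H\to K$. A map $f\colon V(G)\to\Gamma$ is a $\Gamma$-magic map if there is $\gamma\in\Gamma$ with $\sum_{u\in N_G(v)}f(u)=\gamma$ for every $v\in V(G)$, where $N_G(v)$ is the open neighborhood. It is generating if $\langle f(v)\mid v\in V(G)\rangle=\Gamma$, and affinely generating if $\langle f(v)-f(w)\mid v,w\in V(G)\rangle=\Gamma$. A $\Gamma$-distance magic labeling is a bijective $\Gamma$-magic map. Let $\mathbf 1$ be the all-one vector and $\Lambda_{\mathbf 1}=\mathbb Z^{V(G)}/\mathbb Z\mathbf 1$. Since $A\mathbf 1=k\mathbf 1$, $A$ induces the reduced adjacency operator $\overline A\colon\Lambda_{\mathbf 1}\to\Lambda_{\mathbf 1}$, $\overline A([x])=[Ax]$. When $\overline A$ is nonsingular over $\mathbb Q$, its cokernel is finite, and $\mathsf S_{\mathrm{red}}(G)=\Lambda_{\mathbf 1}/\overline A(\Lambda_{\mathbf 1})$ is called the reduced adjacency Smith group of $G$. *)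

(* Defs.v *)
From HB Require Import structures.
From mathcomp Require Import all_boot all_fingroup all_algebra.
From mathcomp Require Import boolp.

Set Implicit Arguments.
Unset Strict Implicit.
Unset Printing Implicit Defensive.

Import GRing.Theory.
Local Open Scope ring_scope.
Local Open Scope quotient_scope.

Record sgraph := SGraph {
  vertex :> finType;
  adj : rel vertex;
  adj_sym : symmetric adj;
  adj_irr : irreflexive adj;
  vertex_gt0 : (0 < #|vertex|)%N }.

Definition nbhd (G : sgraph) (v : G) : {set G} := [set u | adj v u].

Definition regular (k : nat) (G : sgraph) : Prop :=
  forall v : G, #|nbhd v| = k.

(* The vertices are listed by enum_val : 'I_#|G| -> G. *)
Definition adjmx (R : nzRingType) (G : sgraph) : 'M[R]_#|G| :=
  \matrix_(i, j) (adj (enum_val i) (enum_val j))%:R.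

Section Cokernel.
Variables (U V : zmodType) (f : {additive U -> V}).

Definition img : {pred V} := fun y => `[< exists x, f x = y >].

Lemma img_zmod_closed : zmod_closed img.
Proof.
split; first by apply/asboolP; exists 0; rewrite raddf0.
move=> _ _ /asboolP[x <-] /asboolP[y <-]; apply/asboolP.
by exists (x - y); rewrite raddfB.
Qed.

HB.instance Definition _ := GRing.isZmodClosed.Build V img img_zmod_closed.

Definition coker := Quotient.quot (GRing.ZmodClosed.clone V img _).

HB.instance Definition _ := ZmodQuotient.on coker.

End Cokernel.

Definition embeds (H K : zmodType) : Prop :=
  exists f : {additive H -> K}, injective f.

Definition isomorphic (H K : zmodType) : Prop :=
  exists f : {additive H -> K}, bijective f.

(* The least m > 0 with m H = 0; the value 0 is only taken when there is no
   such m, which cannot happen for a finite H. *)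
Definition zexponent (H : zmodType) : nat :=
  let P := fun m : nat => `[< (0 < m)%N /\ forall x : H, x *+ m = 0 >] in
  match pselect (exists m, P m) with
  | left exP => ex_minn exP
  | right _ => 0%N
  end.

Section Reduced.
Variables (R : nzRingType) (G : sgraph).

(* R^V / R1; Lambda int G is the lattice Z^V / Z1, and Lambda rat G is its
   extension of scalars to Q. *)
Definition Lambda := coker (@const_mx R #|G| 1).

HB.instance Definition _ := ZmodQuotient.on Lambda.

Variables (k : nat) (Gk : regular k G).

Lemma adjmx_const (c : R) :
  adjmx R G *m const_mx c = const_mx (k%:R * c) :> 'cV_#|G|.
Proof.
apply/matrixP=> i j; rewrite !mxE.
under eq_bigr do rewrite !mxE.
rewrite -mulr_suml -natr_sum -(Gk (enum_val i)) -sum1_card.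
rewrite (reindex (fun l : 'I_#|G| => enum_val l)) /=;
  last exact/onW_bij/enum_val_bij.
congr (_%:R * c); rewrite [RHS]big_mkcond; apply: eq_bigr => l _.
by rewrite inE; case: adj.
Qed.

Definition Abar_fun (x : Lambda) : Lambda :=
  \pi_Lambda (adjmx R G *m generic_quotient.repr x).

Lemma eq_Lambda (x y : 'cV[R]_#|G|) :
  \pi_Lambda x = \pi_Lambda y <-> exists c, const_mx c = x - y.
Proof.
split=> [/eqP|xy]; first by rewrite -Quotient.idealrBE => /asboolP.
by apply/eqP; rewrite -Quotient.idealrBE; apply/asboolP.
Qed.

Lemma Abar_pi (x : 'cV[R]_#|G|) :
  Abar_fun (\pi_Lambda x) = \pi_Lambda (adjmx R G *m x).
Proof.
apply/eq_Lambda; rewrite -mulmxBr.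
have /eq_Lambda[c <-] : \pi_Lambda (generic_quotient.repr (\pi_Lambda x))
  = \pi_Lambda x by rewrite reprK.
by exists (k%:R * c); rewrite adjmx_const.
Qed.

Lemma Abar_is_zmod_morphism : zmod_morphism Abar_fun.
Proof.
move=> x y; rewrite -[x in LHS]reprK -[y in LHS]reprK -raddfB Abar_pi.
by rewrite mulmxBr raddfB.
Qed.

Definition Abar : {additive Lambda -> Lambda} :=
  HB.pack Abar_fun
    (GRing.isZmodMorphism.Build Lambda Lambda Abar_fun Abar_is_zmod_morphism).

End Reduced.

Section RegularGraph.
Variables (G : sgraph) (k : nat) (Gk : regular k G).

Definition Abar_nonsingular : Prop := bijective (Abar rat Gk).

Definition Sred : zmodType := coker (Abar int Gk).

Definition absdet : nat := `|\det (adjmx int G)|%N.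

(* The truncated quotient absdet G %/ k is therefore exact. *)
Lemma degree_dvd_absdet : (k %| absdet)%N.
Proof.
have /card_gt0P[v _] := vertex_gt0 G.
have E : \det (adjmx int G) = k%:R * (\adj (adjmx int G) *m const_mx 1)
    (enum_rank v) (0 : 'I_1).
  have := congr1 (mulmx^~ (const_mx 1 : 'cV_#|G|)) (mul_adj_mx (adjmx int G)).
  rewrite -mulmxA (adjmx_const Gk) mul_scalar_mx.
  move=> /matrixP/(_ (enum_rank v) 0); rewrite !mxE !mulr1 => <-.
  rewrite mulr_sumr; apply: eq_bigr => i _; rewrite !mxE !mulr1.
  by rewrite mulrC.
by rewrite /absdet E abszM natz absz_nat dvdn_mulr.
Qed.

End RegularGraph.

(* Z/d for d >= 1, on the carrier {0, ..., d - 1}; unlike 'Z_d it is trivial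
   for d = 1. *)
Definition Zmod (d : nat) : finZmodType := 'I_d.-1.+1.

Section DirectSum.
Variable d : seq nat.

Definition dsum := {dffun forall i : 'I_(size d), Zmod (nth 0%N d i)}.

HB.instance Definition _ := Finite.on dsum.

Definition dsum_zero : dsum := [ffun i : 'I_(size d) => 0 : Zmod (nth 0%N d i)].
Definition dsum_opp (x : dsum) : dsum :=
  [ffun i : 'I_(size d) => - x i : Zmod (nth 0%N d i)].
Definition dsum_add (x y : dsum) : dsum :=
  [ffun i : 'I_(size d) => x i + y i : Zmod (nth 0%N d i)].

Fact dsum_addA : associative dsum_add.
Proof. by move=> x y z; apply/ffunP=> i; rewrite !ffunE addrA. Qed.
Fact dsum_addC : commutative dsum_add.
Proof. by move=> x y; apply/ffunP=> i; rewrite !ffunE addrC. Qed.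
Fact dsum_add0 : left_id dsum_zero dsum_add.
Proof. by move=> x; apply/ffunP=> i; rewrite !ffunE add0r. Qed.
Fact dsum_addN : left_inverse dsum_zero dsum_opp dsum_add.
Proof. by move=> x; apply/ffunP=> i; rewrite !ffunE addNr. Qed.

HB.instance Definition _ :=
  GRing.isZmodule.Build dsum dsum_addA dsum_addC dsum_add0 dsum_addN.

End DirectSum.

Definition invariant_factors (d : seq nat) : bool :=
  (d == [:: 1%N]) || [&& d != [::], all (fun m => 1 < m)%N d & sorted dvdn d].

Section MagicMaps.
Variables (G : sgraph) (Gamma : finZmodType).
Implicit Type f : G -> Gamma.

Definition magic f : Prop :=
  exists c : Gamma, forall v : G, \sum_(u in nbhd v) f u = c.

(* <<_>> refers to the additive group of Gamma. *)
Definition generating f : Prop :=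
  <<[set f v | v : G]>>%g = [set: Gamma].

Definition affinely_generating f : Prop :=
  <<[set f v - f w | v : G, w : G]>>%g = [set: Gamma].

Definition distance_magic_labeling f : Prop := magic f /\ bijective f.

End MagicMaps.

(* Main.v *)
(* Let M = (A | 1), an n x (n+1) integer matrix, with Smith form M = L D R and
   diagonal entries s_0 | ... | s_(n-1), nonzero since Abar is nonsingular. The
   columns of M present S_red, so S_red is the direct sum of the Z/s_i. A map f
   is magic with constant c iff M (f, -c) = 0, i.e. iff g = R (f, -c) satisfies
   s_i g_i = 0 for i < n, with g_n free. The kernel of M is spanned by (1, -k),
   so R maps it to +-e_n: hence f is generating iff g_0, ..., g_n generate
   Gamma, and f can be chosen affinely generating iff Gamma is generated by
   some g_0, ..., g_(n-1). Bordering A by the row (0 | 1) gives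
   |det A| = k s_0 ... s_(n-1). Finally, for decreasing divisor chains d and s,
   the sum of the Z/d_i embeds into, resp. is a quotient of, the sum of the
   Z/s_i iff d_i | s_i for all i; a free generator shifts s by a leading 0 and
   so lets the largest d_i escape any constraint. *)

From HB Require Import structures.
Require Import Defs.
From mathcomp Require Import all_boot all_fingroup all_algebra.
From mathcomp Require Import boolp.

Set Implicit Arguments.
Unset Strict Implicit.
Unset Printing Implicit Defensive.

Import GRing.Theory Num.Theory.
Local Open Scope ring_scope.

(** * A counting criterion for divisibility *)

(* Applied to the elements c_0 e_0 + ... + c_t e_t of a group with orders of e_j
   divisible by a, where phi reads off the t coordinates that multiplication by
   b does not kill. With m = a / gcd(a, b), there are m^(t+1) tuples c modulo m
   but only m^t values of phi modulo m, so m = 1. *)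
Lemma pigeonhole_dvd (a b t : nat) (phi : (nat -> nat) -> nat -> int) :
    (0 < a)%N ->
    (forall c c' : nat -> nat,
      (forall l, (l < t)%N -> ((a %/ gcdn a b)%N %| phi c l - phi c' l)%Z) ->
      forall j, (j <= t)%N -> (a %| b%:Z * ((c j)%:Z - (c' j)%:Z))%Z) ->
  (a %| b)%N.
Proof.
move=> a_gt0; set m := (a %/ gcdn a b)%N => phiP.
have g_gt0 : (0 < gcdn a b)%N by rewrite gcdn_gt0 a_gt0.
have am : (m * gcdn a b)%N = a by rewrite divnK ?dvdn_gcdl.
have m_gt0 : (0 < m)%N by move: a_gt0; rewrite -am muln_gt0 => /andP[].
have [m1|m_neq1] := eqVneq m 1%N.
  by apply/gcdn_idPl; rewrite -[RHS]am m1 mul1n.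
have m_gt1 : (1 < m)%N by rewrite ltn_neqAle eq_sym m_neq1.
have m_cop : coprime m (b %/ gcdn a b).
  rewrite /coprime -(eqn_pmul2r g_gt0) mul1n muln_gcdl am.
  by rewrite divnK ?dvdn_gcdr.
pose ext (c : {ffun 'I_t.+1 -> 'I_m}) (j : nat) : nat := c (inord j).
pose res (c : {ffun 'I_t.+1 -> 'I_m}) : {ffun 'I_t -> 'I_m} :=
  [ffun l : 'I_t => Ordinal (ltn_pmod `|(phi (ext c) l %% m)%Z|%N m_gt0)].
suff /leq_card : injective res.
  by rewrite !card_ffun !card_ord leq_exp2l // ltnn.
move=> c c' /ffunP cc'; apply/ffunP=> j; apply: val_inj.
have abc : (a %| b%:Z * ((ext c j)%:Z - (ext c' j)%:Z))%Z.
  apply: phiP (ltn_ord j) => l lt_l; rewrite -eqz_mod_dvd.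
  have := congr1 val (cc' (Ordinal lt_l)); rewrite !ffunE /=.
  have mod_lt x : (`|(x %% m)%Z| < m)%N.
    by rewrite -ltz_nat gez0_abs ?modz_ge0 ?ltz_pmod // -?lt0n.
  rewrite !modn_small // => E.
  by rewrite -[(_ %% _)%Z]gez0_abs 1?E ?gez0_abs ?modz_ge0 // -?lt0n.
(* Dividing [abc] by gcd(a, b) leaves m against the cofactor [b %/ gcdn a b], to which m is
   coprime. *)
have : (m %| `|(ext c j)%:Z - (ext c' j)%:Z|)%N.
  rewrite -(Gauss_dvdr _ m_cop) -(dvdn_pmul2r g_gt0) am.
  rewrite mulnAC divnK ?dvdn_gcdr //.
  by move: abc; rewrite dvdzE abszM.
rewrite -[(m %| _)%N]/(m%:Z %| (ext c j)%:Z - (ext c' j)%:Z)%Z -eqz_mod_dvd.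
rewrite !modz_nat => /eqP[].
by rewrite /ext inord_val !modn_small.
Qed.

(** * Finite abelian groups presented by divisor chains: embeddings and quotients *)

(* H is the direct sum of the Z/s_i, with e_i generating the i-th summand. *)
Definition decomp (H : zmodType) (s : seq nat) : Prop :=
  exists e : nat -> H,
    (forall h, exists x : nat -> int, h = \sum_(i < size s) e i *~ x i) /\
    (forall x : nat -> int, \sum_(i < size s) e i *~ x i = 0 <->
      forall i, (i < size s)%N -> ((nth 1%N s i)%:Z %| x i)%Z).

(* H is a quotient of the direct sum of the Z/s_i, where s_i = 0 stands for an
   unconstrained generator. *)
Definition gens (H : zmodType) (s : seq nat) : Prop :=
  exists2 g : nat -> H,
    forall i, (i < size s)%N -> g i *+ nth 1%N s i = 0 &
    forall h, exists x : nat -> int, h = \sum_(i < size s) g i *~ x i.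

(* The default value 1 lets sequences of different sizes be compared. *)
Definition dvd_nth (s t : seq nat) : Prop :=
  forall i, (nth 1%N s i %| nth 1%N t i)%N.

(** Largest entries come first, so padding by the default 1 keeps a chain a chain, and lists of
    different lengths are aligned at their largest entries. *)
Definition dvd_desc (s : seq nat) : bool := sorted (fun x y => y %| x)%N s.

Lemma dvd_desc_nth s i j :
  dvd_desc s -> (i <= j)%N -> (nth 1%N s j %| nth 1%N s i)%N.
Proof.
move=> ss le_ij; have [lt_js|le_sj] := ltnP j (size s); last first.
  by rewrite [nth _ _ j]nth_default ?dvd1n.
apply: (sorted_leq_nth _ _ 1%N ss) => //; last exact: leq_ltn_trans lt_js.
by move=> y x z yx zy; exact: dvdn_trans zy yx.
Qed.

Lemma mulrz_eq0_dvdz (H : zmodType) (h : H) (m : nat) (x : int) :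
  h *+ m = 0 -> (m%:Z %| x)%Z -> h *~ x = 0.
Proof. by move=> hm /dvdzP[q ->]; rewrite mulrC mulrzA -pmulrn hm mul0rz. Qed.

Lemma sum_mulrzB (H : zmodType) n (e : nat -> H) (x y : nat -> int) :
  \sum_(i < n) e i *~ x i - \sum_(i < n) e i *~ y i =
  \sum_(i < n) e i *~ (x i - y i).
Proof. by rewrite -sumrB; apply: eq_bigr => i _; rewrite mulrzBr. Qed.

Lemma sum_mulrz_eq (H : zmodType) n (e : nat -> H) (x y : nat -> int) :
  \sum_(i < n) e i *~ x i = \sum_(i < n) e i *~ y i <->
  \sum_(i < n) e i *~ (x i - y i) = 0.
Proof.
by rewrite -sum_mulrzB; split=> [->|/eqP]; rewrite ?subrr // subr_eq0 => /eqP.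
Qed.

Lemma sum_mulrz_scale (H : zmodType) n (e : nat -> H) (x : nat -> int)
    (b : int) :
  (\sum_(i < n) e i *~ x i) *~ b = \sum_(i < n) e i *~ (b * x i).
Proof. by rewrite mulrz_suml; apply: eq_bigr => i _; rewrite mulrC mulrzA. Qed.

Lemma decomp_torsion (H : zmodType) s (e : nat -> H) i :
    (forall x : nat -> int, \sum_(i < size s) e i *~ x i = 0 <->
      forall i, (i < size s)%N -> ((nth 1%N s i)%:Z %| x i)%Z) ->
  (i < size s)%N -> e i *+ nth 1%N s i = 0.
Proof.
move=> rel lt_is.
have [_] := rel (fun j => if j == i then (nth 1%N s i)%:Z else 0).
rewrite (bigD1 (Ordinal lt_is)) //= eqxx big1 ?addr0 => [<- // j _|j].
  by have [->|_] := eqVneq j i; rewrite ?dvdzz ?dvdz0.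
by rewrite -val_eqE /= => /negPf ->; rewrite mulr0z.
Qed.

Lemma decomp_isomorphic (H K : zmodType) s :
  isomorphic H K -> decomp K s -> decomp H s.
Proof.
case=> f [g fK gK] [e [gen rel]]; exists (g \o e); split=> [h|x].
  have [x fh] := gen (f h); exists x; apply: (can_inj fK); rewrite fh raddf_sum.
  by apply: eq_bigr => i _; rewrite raddfMz /= gK.
rewrite -rel; have -> : \sum_(i < size s) e i *~ x i =
    f (\sum_(i < size s) (g \o e) i *~ x i).
  by rewrite raddf_sum; apply: eq_bigr => i _; rewrite raddfMz /= gK.
split=> [->|]; first exact: raddf0.
by move=> E; apply: (can_inj fK); rewrite E raddf0.
Qed.

Lemma sum_mulrz_rev (H : zmodType) n (e : nat -> H) (x : nat -> int) :
  \sum_(i < n) e (n - i.+1)%N *~ x i = \sum_(i < n) e i *~ x (n - i.+1)%N.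
Proof.
rewrite (reindex_inj rev_ord_inj); apply: eq_bigr => i _ /=.
by rewrite subnSK // subKn // ltnW.
Qed.

Lemma decomp_rev (H : zmodType) s : decomp H s -> decomp H (rev s).
Proof.
case=> e [gen rel]; exists (fun i => e (size s - i.+1)%N).
rewrite size_rev; split=> [h|x].
  have [x ->] := gen h; exists (fun i => x (size s - i.+1)%N).
  rewrite (sum_mulrz_rev _ e (fun i => x (size s - i.+1)%N)).
  apply: eq_bigr => i _.
  by rewrite subnSK // subKn // ltnW.
rewrite (sum_mulrz_rev _ e x) (rel (fun i => x (size s - i.+1)%N)).
split=> P i lt_is; have lt_is' : (size s - i.+1 < size s)%N.
- by rewrite ltn_subrL (leq_ltn_trans _ lt_is).
- by have := P _ lt_is'; rewrite subnSK // subKn ?nth_rev // ltnW.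
- by rewrite ltn_subrL (leq_ltn_trans _ lt_is).
- by have := P _ lt_is'; rewrite nth_rev // subnSK // subKn // ltnW.
Qed.

Lemma gens_rev (H : zmodType) s : gens H s -> gens H (rev s).
Proof.
case=> g tor gen; exists (fun i => g (size s - i.+1)%N); rewrite size_rev.
  move=> i lt_is; rewrite nth_rev //; apply: tor.
  by rewrite ltn_subrL (leq_ltn_trans _ lt_is).
move=> h; have [x ->] := gen h; exists (fun i => x (size s - i.+1)%N).
rewrite (sum_mulrz_rev _ g (fun i => x (size s - i.+1)%N)).
apply: eq_bigr => i _.
by rewrite subnSK // subKn // ltnW.
Qed.

Lemma nth_gt0 s i : all (fun m => 0 < m)%N s -> (0 < nth 1%N s i)%N.
Proof.
move=> s_gt0; have [lt_is|?] := ltnP i (size s); last by rewrite nth_default.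
exact: (all_nthP 1%N s_gt0).
Qed.

(** The map is e_i -> (t_i / s_i) f_i on chosen coordinates; [rel] yields both independence of the
    choice and injectivity. *)
Lemma embeds_of_dvd_nth (H K : zmodType) s t :
    decomp H s -> decomp K t -> all (fun m => 0 < m)%N t ->
  dvd_nth s t -> embeds H K.
Proof.
case=> e [egen erel] [f [_ frel]] t_gt0 st.
have [x xP] := choice egen.
pose c i : int := (nth 1%N t i %/ nth 1%N s i)%N.
have cs i : c i * (nth 1%N s i)%:Z = nth 1%N t i by rewrite -PoszM divnK.
have c_neq0 i : c i != 0.
  rewrite eqz_nat -lt0n divn_gt0; first exact/dvdn_leq/st/nth_gt0.
  exact: dvdn_gt0 (nth_gt0 _ t_gt0) (st i).
have rel (u v : nat -> int) : \sum_(i < size s) e i *~ u i =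
    \sum_(i < size s) e i *~ v i <->
    \sum_(i < size t) f i *~ (c i * u i) =
    \sum_(i < size t) f i *~ (c i * v i).
  rewrite (sum_mulrz_eq _ e u v) (erel (fun i => u i - v i)).
  rewrite (sum_mulrz_eq _ f (fun i => c i * u i) (fun i => c i * v i)).
  rewrite (frel (fun i => c i * u i - c i * v i)).
  split=> P i _; last have [lt_it|?] := ltnP i (size t).
  - rewrite -mulrBr -cs dvdz_mul2l //.
    by have [/P//|?] := ltnP i (size s); rewrite nth_default // dvd1z.
  - by have := P i lt_it; rewrite -mulrBr -cs dvdz_mul2l.
  (* Past the end of [t] the default 1 forces s_i = 1. *)
  - have := st i; rewrite [nth _ t i]nth_default // dvdn1 => /eqP ->.
    exact: dvd1z.
pose phi h := \sum_(i < size t) f i *~ (c i * x h i).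
have phiB : zmod_morphism phi.
  move=> h h'.
  rewrite /phi (sum_mulrzB _ f (fun i => c i * x h i) (fun i => c i * x h' i)).
  rewrite (rel (x (h - h')) (fun i => x h i - x h' i)).1.
    by apply: eq_bigr => i _; rewrite mulrBr.
  by rewrite -sum_mulrzB -!xP.
pose phi_add : {additive H -> K} :=
  HB.pack phi (GRing.isZmodMorphism.Build H K phi phiB).
exists phi_add => h h' E.
by rewrite (xP h) (xP h'); apply/rel.
Qed.

(** With a = s_k and b = t_k, the elements h(c), the sums of c_j (s_j / a) e_j over j <= k, are
    killed by a. Multiplication by b kills the coordinates l >= k of their images in K, so k
    coordinates must separate k + 1 parameters. *)
Lemma dvd_nth_of_embeds (H K : zmodType) s t :
    decomp H s -> decomp K t -> all (fun m => 0 < m)%N s ->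
    dvd_desc s -> dvd_desc t ->
  embeds H K -> dvd_nth s t.
Proof.
case=> e [_ erel] [f [fgen frel]] s_gt0 s_desc t_desc [phi phi_inj] k.
have [lt_ks|?] := ltnP k (size s); last by rewrite nth_default ?dvd1n.
have [u uP] := choice fgen.
set a := nth _ s k; set b := nth _ t k.
have a_gt0 : (0 < a)%N := nth_gt0 k s_gt0.
pose x (c : nat -> nat) j : int := (c j * (nth 1 s j %/ a))%N *+ (j <= k)%N.
pose h c := \sum_(i < size s) e i *~ x c i.
(* h(c) is killed by lcm(a, b), so t_l divides lcm(a, b) u_l; the quotient serves as the l-th
   coordinate in the count. *)
have tor (c : nat -> nat) l : (l < size t)%N ->
    ((nth 1%N t l)%:Z %| (lcmn a b)%:Z * u (phi (h c)) l)%Z.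
  move: l; apply/(frel (fun l => (lcmn a b)%:Z * u (phi (h c)) l)).
  rewrite -(sum_mulrz_scale _ f) -uP -raddfMz /h (sum_mulrz_scale _ e).
  rewrite (erel (fun i => (lcmn a b)%:Z * x c i)).2 ?raddf0 // => i _.
  rewrite /x; case: leqP => [le_ik|_]; last by rewrite mulr0 dvdz0.
  rewrite mulr1n -PoszM dvdzE /= mulnCA dvdn_mull //.
  have ai : (a %| nth 1%N s i)%N := dvd_desc_nth s_desc le_ik.
  by rewrite -{1}(divnK ai) mulnC dvdn_mul ?dvdn_lcml.
apply: (@pigeonhole_dvd _ _ k
  (fun c l => ((lcmn a b)%:Z * u (phi (h c)) l %/ (nth 1%N t l)%:Z)%Z)) => //.
move=> c c' cc' j le_jk.
have : h c *~ b = h c' *~ b.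
  apply: phi_inj; rewrite !raddfMz [phi (h c)]uP [phi (h c')]uP.
  rewrite !(sum_mulrz_scale _ f).
  apply/(sum_mulrz_eq _ f (fun i => b%:Z * u (phi (h c)) i)
    (fun i => b%:Z * u (phi (h c')) i)).
  apply/(frel (fun i =>
    b%:Z * u (phi (h c)) i - b%:Z * u (phi (h c')) i)) => l lt_lt.
  rewrite -mulrBr; have [lt_lk|le_kl] := ltnP l k; last first.
    exact/dvdz_mulr/(dvd_desc_nth t_desc le_kl).
  have m_gt0 : (0 < a %/ gcdn a b)%N.
    by rewrite divn_gt0 ?gcdn_gt0 ?a_gt0 // dvdn_leq ?dvdn_gcdl.
  (* As lcm(a, b) = m b with m = a / gcd(a, b), quotients congruent modulo m give t_l | b (u_l -
     u'_l). *)
  have mb : (lcmn a b)%:Z = (a %/ gcdn a b)%N%:Z * b%:Z.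
    by rewrite -PoszM /lcmn divn_mulAC ?dvdn_gcdl.
  have m_neq0 : (a %/ gcdn a b)%N%:Z != 0 by rewrite eqz_nat -lt0n.
  rewrite -(dvdz_mul2l m_neq0) mulrA -mb mulrBr.
  rewrite -(divzK (tor c l lt_lt)) -(divzK (tor c' l lt_lt)) -mulrBl.
  by apply: dvdz_mul (dvdzz _); apply: cc'.
rewrite !(sum_mulrz_scale _ e).
move/(sum_mulrz_eq _ e (fun i => b%:Z * x c i) (fun i => b%:Z * x c' i)).
move/(erel (fun i => b%:Z * x c i - b%:Z * x c' i)).
have lt_js := leq_ltn_trans le_jk lt_ks.
move=> /(_ j lt_js); rewrite /x le_jk !mulr1n -mulrBr.
have /dvdnP[q sj] : (a %| nth 1%N s j)%N := dvd_desc_nth s_desc le_jk.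
have : (0 < q * a)%N by rewrite -sj nth_gt0.
rewrite muln_gt0 sj mulnK // !PoszM -mulrBl mulrA (mulrC q%:Z).
move=> /andP[q_gt0 _].
by rewrite dvdz_mul2r ?eqz_nat -?lt0n.
Qed.

(** Coordinates j <= k make sense in H/aH, since a = s_k divides s_j. There b h(c), with b = t_k,
    depends only on the first k coordinates of h(c) along [g], taken modulo a / gcd(a, b). *)
Lemma dvd_nth_of_gens (H : zmodType) s t :
    decomp H s -> all (fun m => 0 < m)%N s -> dvd_desc s -> dvd_desc t ->
  gens H t -> dvd_nth s t.
Proof.
case=> e [egen erel] s_gt0 s_desc t_desc [g gtor ggen] k.
have [lt_ks|?] := ltnP k (size s); last by rewrite nth_default ?dvd1n.
have [u uP] := choice ggen.
set a := nth _ s k; set b := nth _ t k.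
have a_gt0 : (0 < a)%N := nth_gt0 k s_gt0.
pose x (c : nat -> nat) j : int := (c j)%:Z *+ (j <= k)%N.
pose h c := \sum_(i < size s) e i *~ x c i.
apply: (@pigeonhole_dvd _ _ k (fun c l => u (h c) l)) => //.
move=> c c' cc' j le_jk.
(* [w] exhibits b (h(c) - h(c')) as a multiple of a: the terms l >= k vanish because t_l | b, and
   for l < k the coefficient is divisible by lcm(a, b). *)
pose w l : int :=
  if (l < k)%N then (b%:Z * (u (h c) l - u (h c') l) %/ a)%Z else 0.
have E : (h c - h c') *~ b = (\sum_(l < size t) g l *~ w l) *~ a.
  rewrite [in LHS](uP (h c)) [in LHS](uP (h c')) sum_mulrzB.
  rewrite (sum_mulrz_scale _ g (fun l => u (h c) l - u (h c') l)).
  rewrite (sum_mulrz_scale _ g); apply: eq_bigr => l _; rewrite /w.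
  case: ltnP => [lt_lk|le_kl]; last first.
    rewrite mulr0 mulr0z (mulrz_eq0_dvdz (gtor l _)) //.
    exact/dvdz_mulr/(dvd_desc_nth t_desc le_kl).
  congr (_ *~ _); rewrite [RHS]mulrC divzK //.
  have /dvdzP[q ->] := cc' l lt_lk; rewrite mulrCA -PoszM.
  by rewrite -muln_divCA_gcd PoszM dvdz_mull ?dvdz_mulr.
have [y yP] := egen (\sum_(l < size t) g l *~ w l).
move: E; rewrite yP /h (sum_mulrzB _ e (x c) (x c')).
rewrite (sum_mulrz_scale _ e (fun i => x c i - x c' i)) (sum_mulrz_scale _ e y).
move/(sum_mulrz_eq _ e (fun i => b%:Z * (x c i - x c' i))
  (fun i => a%:Z * y i)).
move/(erel (fun i => b%:Z * (x c i - x c' i) - a%:Z * y i)).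
move=> /(_ j (leq_ltn_trans le_jk lt_ks)); rewrite /x le_jk !mulr1n.
have aj : (a%:Z %| (nth 1%N s j)%:Z)%Z := dvd_desc_nth s_desc le_jk.
move/(dvdz_trans aj).
rewrite -[X in _ -> (_ %| X)%Z](subrK (a%:Z * y j)) => dvd_a.
by rewrite rpredD // dvdz_mulr.
Qed.

Lemma gens_of_dvd_nth (H : zmodType) s t :
  decomp H s -> dvd_nth s t -> gens H t.
Proof.
case=> e [egen erel] st.
have e_tor i : (i < size s)%N -> e i *+ nth 1%N s i = 0.
  exact: decomp_torsion erel.
exists (fun i => if (i < size s)%N then e i else 0) => [i _|h].
  case: ifP => [/e_tor ei0|_]; last by rewrite mul0rn.
  by have /dvdnP[q ->] := st i; rewrite mulnC mulrnA ei0 mul0rn.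
have [x ->] := egen h; exists x.
(* Where [t] has ended, s_i divides 1 and e_i vanishes, so cutting the sum at the length of [t]
   loses nothing. *)
have e0 i : (i < size s)%N -> (size t <= i)%N -> e i = 0.
  move=> /e_tor + le_ti; have := st i; rewrite [nth _ t i]nth_default // dvdn1.
  by move=> /eqP -> .
pose F i := if (i < size s)%N then e i *~ x i else 0.
pose N := maxn (size s) (size t).
transitivity (\sum_(i < N) F i).
  rewrite (big_ord_widen N (fun i => e i *~ x i)) ?leq_maxl // big_mkcond.
  by apply: eq_bigr.
rewrite (big_ord_widen N (fun i => (if (i < size s)%N then e i else 0) *~ x i));
  last exact: leq_maxr.
rewrite [RHS]big_mkcond; apply: eq_bigr => i _; rewrite /F.
case: ltnP => [lt_is|_]; last by rewrite mul0rz if_same.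
by case: ltnP => // /(e0 i lt_is) ->; rewrite mul0rz.
Qed.

(** * Sums of cyclic groups: coordinates, order and exponent *)

Lemma Zmod_mulrz_eq0 m (x : int) :
  (0 < m)%N -> (inZp 1 : Zmod m) *~ x = 0 <-> (m%:Z %| x)%Z.
Proof.
(* For m = 1 the carrier is a single point and [inZp 1] is 0, so the trivial summand is covered
   too. *)
move=> m_gt0; have E n : ((inZp 1 : Zmod m) *+ n == 0) = (m %| n)%N.
  by rewrite (Zp_mulrn (inZp 1 : Zmod m)) -val_eqE /= prednK // modnMml mul1n.
have <- : ((inZp 1 : Zmod m) *~ x == 0) = (m%:Z %| x)%Z; last by split=> /eqP.
by case: x => n; rewrite ?NegzE ?mulrNz ?oppr_eq0 -pmulrn E.
Qed.

Lemma decomp_dsum d : all (fun m => 0 < m)%N d -> decomp (dsum d) d.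
Proof.
move=> d_gt0; have d_j_gt0 (j : 'I_(size d)) : (0 < nth 0%N d j)%N.
  exact: (all_nthP 0%N d_gt0).
pose e i : dsum d := [ffun j : 'I_(size d) =>
  (if i == j :> nat then inZp 1 else 0) : Zmod (nth 0%N d j)].
have sumE (x : nat -> int) (j : 'I_(size d)) :
    (\sum_(i < size d) e i *~ x i) j = inZp 1 *~ x j.
  pose ev (h : dsum d) : Zmod (nth 0%N d j) := h j.
  have evB : zmod_morphism ev by move=> g h; rewrite /ev !ffunE.
  pose ev_add : {additive dsum d -> Zmod (nth 0%N d j)} :=
    HB.pack ev (GRing.isZmodMorphism.Build _ _ ev evB).
  have evMz g n : ev (g *~ n) = ev g *~ n := raddfMz ev_add n g.
  have -> : (\sum_(i < size d) e i *~ x i) j =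
      \sum_(i < size d) ev (e i *~ x i).
    exact: (raddf_sum ev_add).
  rewrite (bigD1 j) //= big1 => [|i neq_ij].
    by rewrite evMz /ev ffunE eqxx addr0.
  by rewrite evMz /ev ffunE val_eqE (negPf neq_ij) mul0rz.
exists e; split=> [h|x].
  pose x (i : nat) : int := if insub i is Some j then (h j)%:Z else 0.
  exists x; apply/ffunP=> j; rewrite sumE /x valK -pmulrn.
  rewrite (Zp_mulrn (inZp 1 : Zmod _)); apply: val_inj.
  by rewrite /= modnMml mul1n modn_small.
split=> [/ffunP E i lt_id|E].
  have := E (Ordinal lt_id); rewrite sumE ffunE => /Zmod_mulrz_eq0.
  by rewrite (set_nth_default 0%N) //; apply; exact: (d_j_gt0 (Ordinal lt_id)).
apply/ffunP=> j; rewrite sumE ffunE; apply/Zmod_mulrz_eq0 => //.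
by have := E j (ltn_ord j); rewrite (set_nth_default 0%N).
Qed.

Lemma card_dsum d :
  all (fun m => 0 < m)%N d -> #|dsum d| = (\prod_(m <- d) m)%N.
Proof.
move=> d_gt0; rewrite [LHS]card_dep_ffun.
rewrite (_ : [seq _ | _ : 'I__] = d); first by rewrite unlock.
rewrite -[RHS](mkseq_nth 0%N) /mkseq -val_enum_ord -map_comp.
apply: eq_map => i.
by rewrite card_ord prednK //= (all_nthP 0%N d_gt0).
Qed.

Lemma dvdn_prod_of_dvd_nth s t :
  dvd_nth s t -> (\prod_(m <- s) m %| \prod_(m <- t) m)%N.
Proof.
elim: s t => [|a s IHs] [|b t] st; rewrite ?big_nil ?big_cons ?dvd1n //.
  have := st 0%N; rewrite /= dvdn1 => /eqP ->; rewrite mul1n.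
  have /IHs : dvd_nth s [::] by move=> i; have := st i.+1; rewrite /= nth_nil.
  by rewrite big_nil.
by apply: dvdn_mul; [exact: st 0%N|apply: IHs => i; exact: st i.+1].
Qed.

Lemma zexponentP (H : zmodType) (h : H) : h *+ zexponent H = 0.
Proof.
rewrite /zexponent; case: pselect => [exP|_]; last exact: mulr0n.
by case: ex_minnP => m /asboolP[_ mH] _.
Qed.

Lemma dvd_zexponent_of_embeds (H K : zmodType) s i :
  decomp H s -> embeds H K -> (nth 1%N s i %| zexponent K)%N.
Proof.
case=> e [_ rel] [f f_inj]; have [lt_is|?] := ltnP i (size s); last first.
  by rewrite nth_default ?dvd1n.
(* Constant coefficients test all summands at once: this multiple of the sum of the e_i has image 0
   in K. *)
apply: (rel (fun=> (zexponent K)%:Z)).1 lt_is => /=.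
rewrite -mulrz_suml -pmulrn; apply: f_inj.
by rewrite raddfMn zexponentP raddf0.
Qed.

(** * Generated subgroups, and integer matrices acting on tuples *)

Lemma gen_setT_ind (Gamma : finZmodType) (A : {set Gamma}) (P : Gamma -> Prop) :
    <<A>>%g = [set: Gamma] -> P 0 -> (forall x y, P x -> P y -> P (x + y)) ->
  (forall x, x \in A -> P x) -> forall x, P x.
Proof.
move=> genA P0 PD PA x.
(* In a finite group, a subset containing 0 and closed under addition is a subgroup. *)
have PG : group_set [set y | `[< P y >]].
  apply/group_setP; split=> [|y z]; rewrite !inE; first exact/asboolP.
  by move=> /asboolP Py /asboolP Pz; exact/asboolP/PD.
have : x \in <<A>>%g by rewrite genA inE.
have sAP : A \subset [set y | `[< P y >]].
  by apply/subsetP=> y /PA Py; rewrite inE; apply/asboolP.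
move: sAP; rewrite -(gen_subG _ (Group PG)) => /subsetP/[apply].
by rewrite inE => /asboolP.
Qed.

Lemma mulrz_gen (Gamma : finZmodType) (A : {set Gamma}) x (n : int) :
  x \in <<A>>%g -> x *~ n \in <<A>>%g.
Proof.
move=> xA; have X m : x *+ m \in <<A>>%g.
  elim: m => [|m IHm]; first by rewrite mulr0n -FinRing.zmod1gE group1.
  by rewrite mulrS -FinRing.zmodMgE groupM.
case: n => n; first exact: X.
by rewrite NegzE mulrNz -FinRing.zmodVgE groupV -pmulrn X.
Qed.

Lemma sum_gen (Gamma : finZmodType) (A : {set Gamma}) (I : finType) (P : pred I)
    (F : I -> Gamma) :
  (forall i, P i -> F i \in <<A>>%g) -> \sum_(i | P i) F i \in <<A>>%g.
Proof.
move=> FA; elim/big_ind: _ => // [|x y xA yA].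
  by rewrite -FinRing.zmod1gE group1.
by rewrite -FinRing.zmodMgE groupM.
Qed.

(** The product of [M] with a column over the Z-module [Gamma]. *)
Definition mxact (Gamma : zmodType) p q (M : 'M[int]_(p, q)) (x : 'I_q -> Gamma)
  (i : 'I_p) : Gamma := \sum_j x j *~ M i j.

Lemma mxactM (Gamma : zmodType) p q r (M : 'M[int]_(p, q)) (N : 'M_(q, r))
    (x : 'I_r -> Gamma) i :
  mxact (M *m N) x i = mxact M (mxact N x) i.
Proof.
rewrite /mxact; under eq_bigr do rewrite mxE mulrz_sumr.
rewrite exchange_big; apply: eq_bigr => l _; rewrite mulrz_suml.
by apply: eq_bigr => j _; rewrite mulrC mulrzA.
Qed.

Lemma mxact1 (Gamma : zmodType) p (x : 'I_p -> Gamma) i : mxact 1%:M x i = x i.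
Proof.
rewrite /mxact (bigD1 i) //= big1 => [|j neq_ji]; rewrite !mxE ?eqxx ?addr0 //.
by rewrite eq_sym (negPf neq_ji).
Qed.

Lemma eq_mxact (Gamma : zmodType) p q (M : 'M[int]_(p, q))
    (x y : 'I_q -> Gamma) :
  x =1 y -> mxact M x =1 mxact M y.
Proof. by move=> xy i; apply: eq_bigr => j _; rewrite xy. Qed.

Lemma mxact0 (Gamma : zmodType) p q (M : 'M[int]_(p, q)) (x : 'I_q -> Gamma) i :
  (forall j, x j = 0) -> mxact M x i = 0.
Proof. by move=> x0; apply: big1 => j _; rewrite x0 mul0rz. Qed.

(** * The augmented adjacency matrix and its Smith form *)

(* Its column span is the preimage of the image of Abar in Z^V, and its kernel
   over a group consists of the pairs (f, -c) with f magic of constant c. *)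
Definition augmx (G : sgraph) : 'M[int]_(#|G|, #|G| + 1) :=
  row_mx (adjmx int G) (const_mx 1).

Lemma adjmx_tr (R : nzRingType) (G : sgraph) : (adjmx R G)^T = adjmx R G.
Proof. by apply/matrixP=> i j; rewrite !mxE adj_sym. Qed.

(** A is symmetric, so the transpose of y lies in ker A and, by injectivity of [Abar] over Q, is a
    constant vector c. Multiplying y by the column 1 then gives |G| c = 0. *)
Lemma nonsingular_ker (G : sgraph) k (Gk : regular k G) (y : 'rV[int]_#|G|) :
  Abar_nonsingular Gk -> y *m augmx G = 0 -> y = 0.
Proof.
move=> /bij_inj A_inj; rewrite mul_mx_row => /eqP; rewrite row_mx_eq0.
move=> /andP[/eqP yA /eqP y1]; pose z : 'cV[rat]_#|G| := map_mx intr y^T.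
have Az : adjmx rat G *m z = 0.
  have -> : adjmx rat G = map_mx intr (adjmx int G).
    by apply/matrixP=> i j; rewrite !mxE; case: adj.
  by rewrite -map_mxM -[adjmx _ _]adjmx_tr -trmx_mul yA trmx0 map_mx0.
have /A_inj/eq_Lambda[c] :
    Abar rat Gk (\pi_(Lambda rat G)%qT z) =
    Abar rat Gk (\pi_(Lambda rat G)%qT 0).
  by rewrite [LHS](Abar_pi Gk) [RHS](Abar_pi Gk) Az mulmx0.
rewrite subr0 => zc.
have yc i : (y 0 i)%:~R = c by have /matrixP/(_ i 0) := zc; rewrite !mxE.
have /matrixP/(_ 0 0) := y1; rewrite !mxE.
move/(congr1 (fun x : int => x%:~R : rat)).
rewrite rmorph_sum /= (eq_bigr (fun=> c)) => [|i _]; last first.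
  by rewrite mxE mulr1 yc.
rewrite sumr_const card_ord => /eqP.
rewrite mulrn_eq0 -leqn0 leqNgt vertex_gt0 /=.
move=> /eqP c0; apply/matrixP=> i j; rewrite mxE ord1; apply/eqP.
by rewrite -(intr_eq0 rat) yc c0.
Qed.

Record smith_aug (G : sgraph) (L : 'M[int]_#|G|) (R : 'M[int]_(#|G| + 1))
    (d : nat -> int) : Prop := SmithAug {
  sa_L : L \in unitmx;
  sa_R : R \in unitmx;
  sa_eq : augmx G = L *m row_mx (diag_mx (\row_i d i)) 0 *m R;
  sa_neq0 : forall i : 'I_#|G|, d i != 0;
  sa_dvd : forall i j, (i <= j)%N -> (d i %| d j)%Z }.

Lemma smith_augmx (G : sgraph) k (Gk : regular k G) :
  Abar_nonsingular Gk -> exists L R d, @smith_aug G L R d.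
Proof.
move=> A_ns.
have [L uL [R uR [d d_sorted E]]] := int_Smith_normal_form (augmx G).
have {}E : augmx G = L *m row_mx (diag_mx (\row_i d`_i)) 0 *m R.
  rewrite E; congr (_ *m _ *m _); apply/matrixP=> i j; rewrite !mxE.
  case: splitP => l jl; rewrite !mxE jl //.
  by rewrite ltn_eqF // ltn_addr.
exists L, R, (fun i => d`_i); split=> // [i|i j le_ij].
  (* If d_i = 0, row i of L^-1 annihilates [augmx G], hence vanishes, which is impossible in an
     invertible matrix. *)
  apply/eqP=> di0; have := nonsingular_ker (y := row i (invmx L)) A_ns.
  rewrite E !mulmxA -row_mul mulVmx // -row_mul mul1mx.
  have -> : row i (row_mx (diag_mx (\row_i d`_i)) 0) = 0 :> 'rV[int]_(#|G| + 1).
    apply/matrixP=> a b; rewrite !mxE; case: splitP => l _; rewrite !mxE //.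
    by case: eqP => // ->.
  rewrite mul0mx => /(_ erefl) Li0.
  have := congr1 (row i) (mulVmx uL); rewrite row_mul Li0 mul0mx.
  by move/matrixP/(_ 0 i); rewrite !mxE eqxx.
have [lt_jd|?] := ltnP j (size d); last by rewrite [d`_j]nth_default ?dvdz0.
apply: (sorted_leq_nth _ _ 0 d_sorted) => //; last exact: leq_ltn_trans lt_jd.
  by move=> y x z; exact: dvdz_trans.
exact: dvdzz.
Qed.

(** * The reduced Smith group and the determinant in Smith coordinates *)

Section Smith.
Variables (G : sgraph) (L : 'M[int]_#|G|) (R : 'M[int]_(#|G| + 1)).
Variable d : nat -> int.
Hypothesis smith : smith_aug L R d.

Let D : 'M[int]_(#|G|, #|G| + 1) := row_mx (diag_mx (\row_i d i)) 0.
Let M_LDR : augmx G = L *m D *m R := sa_eq smith.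

Definition smith_orders : seq nat := mkseq (fun i => `|d i|%N) #|G|.

Let size_orders : size smith_orders = #|G|.
Proof. exact: size_mkseq. Qed.

Let nth_orders i : (i < #|G|)%N -> nth 1%N smith_orders i = `|d i|%N.
Proof. exact: nth_mkseq. Qed.

Lemma smith_orders_gt0 : all (fun m => 0 < m)%N smith_orders.
Proof.
apply/(all_nthP 1%N) => i; rewrite size_orders => lt_i; rewrite nth_orders //.
by rewrite absz_gt0 (sa_neq0 smith (Ordinal lt_i)).
Qed.

Lemma smith_orders_desc : dvd_desc (rev smith_orders).
Proof.
rewrite /dvd_desc rev_sorted; apply/(sortedP 1%N) => i.
rewrite size_orders => lt_i; rewrite !nth_orders ?(ltnW lt_i) //.
exact: (sa_dvd smith (leqnSn i)).
Qed.

Let D_mulmx p (y : 'M[int]_(#|G| + 1, p)) i j :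
  (D *m y) i j = d i * y (lshift 1 i) j.
Proof.
rewrite -{1}[y]vsubmxK mul_row_col mul0mx addr0 mul_diag_mx.
by rewrite !mxE.
Qed.

(** The kernel of Z^V -> S_red is the column span of L D R. As R is invertible, it is spanned by the
    d_i multiples of the columns of L, and these columns form a basis of Z^V. *)
Lemma decomp_Sred k (Gk : regular k G) : decomp (Sred Gk) smith_orders.
Proof.
pose pL (x : 'cV[int]_#|G|) : Lambda int G := \pi_(Lambda int G)%qT x.
pose pS (x : 'cV[int]_#|G|) : Sred Gk := \pi_(coker (Abar int Gk))%qT (pL x).
have pSB : zmod_morphism pS by move=> x y; rewrite /pS /pL !raddfB.
pose p : {additive 'cV[int]_#|G| -> Sred Gk} :=
  HB.pack pS (GRing.isZmodMorphism.Build _ _ pS pSB).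
have p0 x : p x = 0 <-> exists w, x = augmx G *m w.
  have -> : p x = 0 <-> exists z, Abar int Gk z = pL x.
    have -> : 0 = \pi_(coker (Abar int Gk))%qT 0 :> Sred Gk by rewrite raddf0.
    rewrite -[pL x in X in _ <-> X]subr0.
    split=> [/eqP|xy]; first by rewrite -Quotient.idealrBE => /asboolP.
    by apply/eqP; rewrite -Quotient.idealrBE; apply/asboolP.
  split=> [[z Az]|[w ->]].
    have : Abar int Gk (pL (generic_quotient.repr z)) = pL x
      by rewrite /pL reprK.
    rewrite [LHS](Abar_pi Gk) => /eq_Lambda[c E].
    (* [E] says that A z - x is the constant vector c, so the extra column gets the coefficient
       -c. *)
    exists (col_mx (generic_quotient.repr z) (const_mx (- c))).
    rewrite mul_row_col.
    rewrite -[LHS](subKr (adjmx int G *m generic_quotient.repr z)) -E.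
    congr (_ + _); apply/matrixP=> i j; rewrite !mxE big_ord1 !mxE.
    by rewrite mul1r.
  exists (pL (usubmx w)); rewrite [LHS](Abar_pi Gk); apply/eq_Lambda.
  have wE : augmx G *m w = adjmx int G *m usubmx w + const_mx 1 *m dsubmx w.
    by rewrite -mul_row_col vsubmxK.
  exists (- w (rshift _ 0) 0); rewrite wE opprD addNKr.
  by apply/matrixP=> i j; rewrite !mxE big_ord1 !mxE [j]ord1 mul1r.
have sumE (x : nat -> int) :
    \sum_(i < #|G|) p (col i L) *~ x i = p (L *m \col_i x i).
  have -> : L *m \col_i x i = \sum_(i < #|G|) col i L *~ x i.
    apply/matrixP=> a b; rewrite mxE summxE; apply: eq_bigr => i _.
    by rewrite -scaler_int !mxE mulrC intz.
  by rewrite raddf_sum; apply: eq_bigr => i _; rewrite raddfMz.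
exists (fun i => if insub i is Some j then p (col j L) else 0).
rewrite size_orders.
have E (x : nat -> int) : \sum_(i < #|G|)
    (if insub (i : nat) is Some j then p (col j L) else 0) *~ x i =
    p (L *m \col_i x i).
  by rewrite -sumE; apply: eq_bigr => i _; rewrite valK.
split=> [h|x].
  pose y : 'cV_#|G| := generic_quotient.repr (generic_quotient.repr h).
  pose x (i : nat) : int := if insub i is Some j then (invmx L *m y) j 0 else 0.
  exists x; rewrite E (_ : \col_i x i = invmx L *m y).
    by rewrite mulKVmx ?(sa_L smith) // /p /= /pS /pL !reprK.
  by apply/matrixP=> i j; rewrite mxE /x valK ord1.
rewrite E p0; split=> [[w Ew] i lt_i|dx].
  rewrite nth_orders //; have : \col_i x i = D *m (R *m w).
    rewrite -[LHS](mulKmx (sa_L smith)) Ew M_LDR -!mulmxA.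
    by rewrite mulKmx ?(sa_L smith).
  move/matrixP/(_ (Ordinal lt_i) 0); rewrite D_mulmx mxE /= => ->.
  by rewrite dvdzE abszM dvdn_mulr.
(* The divisions are exact by [dx]; the unconstrained last coordinate is set to 0. *)
exists (invmx R *m col_mx (\col_i (x i %/ d i)%Z) 0).
rewrite M_LDR -!mulmxA mulKVmx ?(sa_R smith) //; congr (_ *m _).
apply/matrixP=> i j; rewrite D_mulmx col_mxEu !mxE mulrC divzK //.
by have := dx i (ltn_ord i); rewrite nth_orders.
Qed.

(* tau spans the kernel of augmx G: it is the constant labeling 1, with magic
   constant k. *)
Let tau k : 'cV[int]_(#|G| + 1) := col_mx (const_mx 1) (const_mx (- k%:Z)).

Let augmx_tau k : regular k G -> augmx G *m tau k = 0.
Proof.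
move=> Gk; rewrite mul_row_col (adjmx_const Gk); apply/matrixP=> i j.
by rewrite !mxE big_ord1 !mxE mulr1 mul1r natz subrr.
Qed.

(** L cancels in L D (R tau) = 0, and the d_i are nonzero, so only the last coordinate of R tau
    survives. *)
Let R_tau k (i : 'I_#|G|) : regular k G -> (R *m tau k) (lshift 1 i) 0 = 0.
Proof.
move=> /augmx_tau; rewrite M_LDR -!mulmxA => /(congr1 (mulmx (invmx L))).
rewrite mulmx0 mulKmx ?(sa_L smith) // => /matrixP/(_ i 0).
rewrite D_mulmx [RHS]mxE => /eqP.
by rewrite mulf_eq0 (negPf (sa_neq0 smith i)) => /eqP.
Qed.

(** [R_tau] read row by row; it trades row sums over the vertices for the last column of R. *)
Let R_tau_sum k (i : 'I_#|G|) : regular k G ->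
  \sum_v R (lshift 1 i) (lshift 1 v) = R (lshift 1 i) (rshift _ 0) * k%:Z.
Proof.
move=> Gk; have := R_tau i Gk; rewrite mxE big_split_ord big_ord1 /= => /eqP.
rewrite col_mxEd mxE mulrN subr_eq0 => /eqP <-; apply: eq_bigr => v _.
by rewrite col_mxEu mxE mulr1.
Qed.

(** Apply R^-1 to R tau, which is supported on the last coordinate. *)
Let invR_tau k : regular k G -> exists a : int, forall j,
  tau k j 0 = a * invmx R j (rshift _ 0).
Proof.
move=> Gk; exists ((R *m tau k) (rshift _ 0) 0) => j.
rewrite -{1}[tau k](mulKmx (sa_R smith)) [LHS]mxE big_split_ord big_ord1 /=.
by rewrite big1 ?add0r 1?mulrC // => i _; rewrite R_tau ?mulr0.
Qed.

Let invR_const k v w : regular k G ->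
  invmx R (lshift 1 v) (rshift _ 0) = invmx R (lshift 1 w) (rshift _ 0).
Proof.
move=> /invR_tau[a aE]; have a_neq0 : a != 0.
  have := aE (lshift 1 v); rewrite col_mxEu mxE.
  by case: eqP => // ->; rewrite mul0r.
by apply: (mulfI a_neq0); rewrite -!aE !col_mxEu !mxE.
Qed.

Let invR_corner k : regular k G ->
  `|invmx R (rshift _ 0%R) (rshift _ 0%R)|%N = k.
Proof.
move=> /invR_tau[a aE]; have [v _] := card_gt0P (vertex_gt0 G).
(* tau has an entry 1, so a divides 1. *)
have a1 : `|a|%N = 1%N.
  have := aE (lshift 1 (enum_rank v)); rewrite col_mxEu mxE => /(congr1 absz).
  by rewrite abszM => /esym/eqP; rewrite muln_eq1 => /andP[/eqP].
have := aE (rshift _ 0); rewrite col_mxEd mxE => /(congr1 absz).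
by rewrite abszM a1 mul1n abszN.
Qed.

Let absz_det_unit n (X : 'M[int]_n) : X \in unitmx -> `|\det X|%N = 1%N.
Proof.
move=> /mulmxV/(congr1 (fun Y => `|\det Y|%N)); rewrite det_mulmx det1 abszM.
by move=> /eqP; rewrite muln_eq1 => /andP[/eqP].
Qed.

Lemma absdet_smith k : regular k G ->
  absdet G = (k * \prod_(m <- smith_orders) m)%N.
Proof.
move=> Gk; pose bot : 'rV[int]_(#|G| + 1) := row_mx 0 (const_mx 1).
(* [w] is the row that R carries to the bordering row (0 | 1). *)
pose w := bot *m invmx R.
have E : block_mx (adjmx int G) (const_mx 1) 0 (const_mx 1) =
    block_mx L 0 0 (1%:M : 'M_1) *m
    block_mx (diag_mx (\row_i d i)) 0 (lsubmx w) (rsubmx w) *m R.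
  rewrite /block_mx -[row_mx (lsubmx w) _]/(row_mx (lsubmx w) (rsubmx w)).
  rewrite hsubmxK.
  rewrite -[col_mx (row_mx L 0) _]/(block_mx L 0 0 1%:M) mul_block_col.
  rewrite !mul0mx addr0 add0r mul1mx mul_col_mx -M_LDR.
  by rewrite /w mulmxKV ?(sa_R smith).
have := congr1 (fun X => `|\det X|%N) E; rewrite !det_mulmx det_ublock !abszM.
rewrite det_ublock det_lblock !det_mx11 !abszM (absz_det_unit (sa_L smith)).
rewrite (absz_det_unit (sa_R smith)) /absdet det_diag [const_mx _ _ _]mxE.
rewrite [1%:M _ _]mxE eqxx !muln1 mul1n => ->.
(* The last diagonal entry of the lower triangular middle factor is the corner of R^-1, which is k
   up to sign. *)
have -> : `|rsubmx w 0%R 0%R|%N = k.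
  rewrite -[RHS](invR_corner Gk) mxE /w mxE big_split_ord big_ord1 /=.
  rewrite big1 ?add0r => [|i _]; first by rewrite row_mxEr mxE mul1r.
  by rewrite row_mxEl mxE mul0r.
rewrite mulnC big_map -[X in iota 0 X]subn0 big_mkord; congr (_ * _)%N.
rewrite (big_morph absz abszM (erefl : `|1%Z|%N = 1%N)).
by apply: eq_bigr => i _; rewrite mxE.
Qed.

(** * Magic maps in Smith coordinates *)

Section Magic.
Variable Gamma : finZmodType.
Implicit Types (f : G -> Gamma) (c : Gamma) (x g : 'I_(#|G| + 1) -> Gamma).

Let aug f c (j : 'I_(#|G| + 1)) : Gamma :=
  match split j with inl i => f (enum_val i) | inr _ => - c end.

Let augl f c i : aug f c (lshift 1 i) = f (enum_val i).
Proof. by rewrite /aug -[lshift 1 i]/(unsplit (inl i)) unsplitK. Qed.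

Let augr f c : aug f c (rshift _ 0) = - c.
Proof. by rewrite /aug -[rshift _ 0]/(unsplit (inr 0)) unsplitK. Qed.

Let act_augmx x i : mxact (augmx G) x i =
  \sum_(u in nbhd (enum_val i)) x (lshift 1 (enum_rank u)) + x (rshift _ 0).
Proof.
rewrite /mxact big_split_ord /= big_ord1 row_mxEr mxE; congr (_ + _).
rewrite [RHS](reindex (fun l : 'I_#|G| => enum_val l)) /=;
  last exact/onW_bij/enum_val_bij.
rewrite [RHS]big_mkcond; apply: eq_bigr => l _.
by rewrite inE row_mxEl mxE enum_valK; case: adj.
Qed.

Let act_aug f c : (forall v, \sum_(u in nbhd v) f u = c) ->
  forall i, mxact (augmx G) (aug f c) i = 0.
Proof.
move=> fc i; rewrite act_augmx augr -(fc (enum_val i)); apply/eqP.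
by rewrite subr_eq0; apply/eqP; apply: eq_bigr => u _; rewrite augl enum_rankK.
Qed.

Let act_D x i : mxact D x i = x (lshift 1 i) *~ d i.
Proof.
rewrite /mxact big_split_ord /= big_ord1 row_mxEr [X in _ + _ *~ X]mxE.
rewrite mulr0z addr0 (bigD1 i) //= big1 ?addr0 => [|j ji];
  rewrite row_mxEl !mxE ?eqxx // eq_sym.
by rewrite (negPf ji).
Qed.

(** In L D (R x) = 0 the factor L cancels, leaving d_i (R x)_i = 0. *)
Let act_D_R x : (forall i, mxact (augmx G) x i = 0) ->
  forall i, mxact R x (lshift 1 i) *+ `|d i|%N = 0.
Proof.
move=> x0 i; have : mxact R x (lshift 1 i) *~ d i = 0.
  rewrite -act_D -mxactM -[D](mulKmx (sa_L smith)) -mulmxA -M_LDR mxactM.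
  exact: mxact0.
case: (d i) => // n; rewrite NegzE mulrNz -pmulrn => /eqP.
by rewrite oppr_eq0 => /eqP.
Qed.

Let size_rcons_orders : size (rcons smith_orders 0%N) = (#|G| + 1)%N.
Proof. by rewrite size_rcons size_orders addn1. Qed.

Let act_invR x i : x i = mxact (invmx R) (mxact R x) i.
Proof. by rewrite -mxactM mulVmx ?(sa_R smith) // mxact1. Qed.

(** With g = R (f, -c), the values of f are entries of R^-1 g, so g generates as well. The appended
    0 belongs to the free coordinate g_n. *)
Lemma gens_of_generating f :
  magic f -> generating f -> gens Gamma (rcons smith_orders 0%N).
Proof.
move=> [c fc] gen_f; pose g := mxact R (aug f c).
have g_tor := act_D_R (act_aug fc).
exists (fun j => if insub j is Some i then g i else 0).
  move=> j; rewrite size_rcons size_orders ltnS nth_rcons size_orders => le_jn.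
  case: ltngtP le_jn => // lt_jn _.
  rewrite nth_orders // -[X in insub X]/(val (lshift 1 (Ordinal lt_jn))) valK.
  exact: (g_tor (Ordinal lt_jn)).
suff gen_g : forall h, exists y : 'I_(#|G| + 1) -> int, h = \sum_i g i *~ y i.
  move=> h; have [y ->] := gen_g h.
  exists (fun j => if insub j is Some i then y i else 0).
  rewrite size_rcons_orders; apply: eq_bigr => i _.
  by rewrite valK.
apply: (gen_setT_ind gen_f) => [|_ _ [y ->] [z ->]|_ /imsetP[v _ ->]].
- by exists (fun=> 0); rewrite big1 // => i _; rewrite mulr0z.
- exists (fun i => y i + z i); rewrite -big_split; apply: eq_bigr => i _.
  by rewrite mulrzDr.
- exists (fun i => invmx R (lshift 1 (enum_rank v)) i).
  by rewrite -[RHS]/(mxact _ _ _) -act_invR augl enum_rankK.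
Qed.

(** The last column of R^-1 is constant on the vertices, so g_n cancels in every f(v) - f(w). *)
Lemma gens_of_affinely_generating k f : regular k G ->
  magic f -> affinely_generating f -> gens Gamma smith_orders.
Proof.
move=> Gk [c fc] gen_f; pose g := mxact R (aug f c).
have g_tor := act_D_R (act_aug fc).
exists (fun j => if insub j is Some i then g (lshift 1 i) else 0).
  move=> j; rewrite size_orders => lt_jn; rewrite nth_orders //.
  rewrite -[X in insub X]/(val (Ordinal lt_jn)) valK.
  exact: (g_tor (Ordinal lt_jn)).
suff gen_g : forall h, exists y : 'I_#|G| -> int,
    h = \sum_i g (lshift 1 i) *~ y i.
  move=> h; have [y ->] := gen_g h.
  exists (fun j => if insub j is Some i then y i else 0).
  by rewrite size_orders; apply: eq_bigr => i _; rewrite valK.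
apply: (gen_setT_ind gen_f) => [|_ _ [y ->] [z ->]|_ /imset2P[v w _ _ ->]].
- by exists (fun=> 0); rewrite big1 // => i _; rewrite mulr0z.
- exists (fun i => y i + z i); rewrite -big_split; apply: eq_bigr => i _.
  by rewrite mulrzDr.
- pose r u i := invmx R (lshift 1 (enum_rank u)) i.
  exists (fun i => r v (lshift 1 i) - r w (lshift 1 i)).
  have fE u : f u = \sum_i g i *~ r u i.
    by rewrite -[RHS]/(mxact _ _ _) -act_invR augl enum_rankK.
  rewrite !fE -sumrB big_split_ord /= big_ord1 /r.
  rewrite (invR_const _ (enum_rank w) Gk) subrr addr0.
  by apply: eq_bigr => i _; rewrite mulrzBr.
Qed.

(** Put (f, -c) = R^-1 g: the torsion conditions say D g = 0, so (f, -c) is in the kernel of L D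
    R. *)
Let magic_of g : (forall i : 'I_#|G|, g (lshift 1 i) *+ `|d i|%N = 0) ->
  exists f c, (forall v, \sum_(u in nbhd v) f u = c) /\
    forall i, g i = mxact R (aug f c) i.
Proof.
move=> g_tor; pose x := mxact (invmx R) g.
pose f v := x (lshift 1 (enum_rank v)); pose c := - x (rshift _ 0).
have gE i : g i = mxact R x i by rewrite -mxactM mulmxV ?(sa_R smith) // mxact1.
have x0 i : mxact (augmx G) x i = 0.
  rewrite M_LDR !mxactM; apply: mxact0 => j; rewrite -(eq_mxact _ gE) act_D.
  have := g_tor j; case: (d j) => // n.
  by rewrite NegzE mulrNz -pmulrn => ->; rewrite oppr0.
have xE : x =1 aug f c.
  move=> j; rewrite -[j]splitK; case: split => i /=.
    by rewrite augl /f enum_valK.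
  by rewrite [i]ord1 augr opprK.
exists f, c; split=> // [v|i]; last by rewrite gE; exact: eq_mxact.
have := x0 (enum_rank v); rewrite act_augmx enum_rankK => /eqP.
by rewrite addr_eq0 => /eqP.
Qed.

Lemma generating_of_gens : gens Gamma (rcons smith_orders 0%N) ->
  exists f, magic f /\ generating f.
Proof.
move=> [g tor gen].
have g_tor (i : 'I_#|G|) : (g \o val) (lshift 1 i) *+ `|d i|%N = 0.
  have := tor i; rewrite size_rcons size_orders nth_rcons size_orders.
  by rewrite ltn_ord nth_orders //; apply; rewrite ltnW // ltnS.
have [f [c [fc gE]]] := magic_of g_tor; exists f; split; first by exists c.
apply/setP=> h; rewrite inE; have [y ->] := gen h.
rewrite size_rcons_orders; apply: sum_gen => j _; apply: mulrz_gen.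
rewrite -[g j]/((g \o val) j) gE; apply: sum_gen => i _; apply: mulrz_gen.
have f_gen v : f v \in <<[set f v | v : G]>>%g by rewrite mem_gen ?imset_f.
rewrite -[i]splitK; case: split => l /=; first by rewrite augl.
(* The magic constant is a neighborhood sum at some vertex, hence in the subgroup generated by f. *)
have [v _] := card_gt0P (vertex_gt0 G).
by rewrite [l]ord1 augr -(fc v) -FinRing.zmodVgE groupV sum_gen.
Qed.

Lemma affinely_generating_of_gens k : regular k G ->
  gens Gamma smith_orders -> exists f, magic f /\ affinely_generating f.
Proof.
move=> Gk [g tor gen].
(* The free coordinate g_n is set to 0. *)
pose g0 (j : 'I_(#|G| + 1)) := if (j < #|G|)%N then g j else 0.
have g0l (i : 'I_#|G|) : g0 (lshift 1 i) = g i by rewrite /g0 /= ltn_ord.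
have g_tor (i : 'I_#|G|) : g0 (lshift 1 i) *+ `|d i|%N = 0.
  by rewrite g0l -(nth_orders (ltn_ord i)) tor ?size_orders.
have [f [c [fc gE]]] := magic_of g_tor; exists f; split; first by exists c.
apply/setP=> h; rewrite inE; have [y ->] := gen h.
rewrite size_orders; apply: sum_gen => j _; apply: mulrz_gen.
have [v0 _] := card_gt0P (vertex_gt0 G).
set A := [set _ | _ : G, _ : G].
have df v w : f v - f w \in <<A>>%g.
  by rewrite mem_gen //; apply/imset2P; exists v w.
(* This is the sum of f(v0) - f(u) over the k neighbors u of v0. *)
have kc : f v0 *+ k - c \in <<A>>%g.
  by rewrite -(fc v0) -(Gk v0) -sumr_const -sumrB sum_gen.
rewrite -g0l gE /mxact big_split_ord /= big_ord1 augr.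
(* Split f(v) as (f(v) - f(v0)) + f(v0). By [R_tau_sum] the f(v0) terms and the constant combine
   into a multiple of k f(v0) - c. *)
rewrite (eq_bigr (fun v =>
  (f (enum_val v) - f v0) *~ R (lshift 1 j) (lshift 1 v) +
  f v0 *~ R (lshift 1 j) (lshift 1 v))) => [|v _]; last first.
  by rewrite augl -mulrzDl subrK.
rewrite big_split /= -mulrz_sumr (R_tau_sum _ Gk) mulrC mulrzA -addrA -mulrzDl.
rewrite -pmulrn -FinRing.zmodMgE groupM ?mulrz_gen //.
by apply: sum_gen => v _; rewrite mulrz_gen.
Qed.

End Magic.
End Smith.

(** * Reduction of the three statements to divisibility between chains *)

Theorem corollary1p3 (G : sgraph) (k : nat) (Gk : regular k G)
    (Gamma : finZmodType) (d : seq nat)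
    (k_gt0 : (0 < k)%N)
    (d_inv : invariant_factors d)
    (Gamma_d : isomorphic Gamma (dsum d))
    (A_ns : Abar_nonsingular Gk) :
  let r := size d in
  let d_r := nth 0%N d r.-1 in
  let B := dsum (take r.-1 d) in
  let S := Sred Gk in
  (* (a) *)
  [/\ ((exists f : G -> Gamma, magic f /\ generating f) <-> embeds B S)
    & (2 <= r)%N ->
      (exists f : G -> Gamma, magic f /\ generating f) ->
      (nth 0%N d r.-2 %| zexponent S)%N
      /\ (#|Gamma| %/ d_r %| absdet G %/ k)%N] /\
  (* (b) *)
  [/\ ((exists f : G -> Gamma, magic f /\ affinely_generating f)
        <-> embeds Gamma S)
    & (exists f : G -> Gamma, magic f /\ affinely_generating f) ->
      (d_r %| zexponent S)%N /\ (#|Gamma| %| absdet G %/ k)%N] /\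
  (* (c) *)
  (#|G| = #|Gamma| ->
   (exists f : G -> Gamma, distance_magic_labeling f) ->
   [/\ embeds Gamma S,
       (d_r %| zexponent S)%N
     & (#|Gamma| %| absdet G %/ k)%N]).
Proof.
have [d_neq0 d_gt0 d_sorted] :
    [/\ d != [::], all (fun m => 0 < m)%N d & sorted dvdn d].
  case/orP: d_inv => [/eqP -> //|/and3P[-> d_gt1 ->]]; split=> //.
  by apply: sub_all d_gt1 => m; exact: ltnW.
(* From here on [x] is d_r, and [d] lists the factors of B_Gamma. *)
clear d_inv; case/lastP: d d_neq0 d_gt0 d_sorted Gamma_d => // d x _.
move=> dx_gt0 dx_sorted Gamma_d.
rewrite size_rcons /= (nth_rcons _ _ _ (size d)) ltnn eqxx.
rewrite -[in take _ _]cats1 take_size_cat //.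
have [L [R [e smith]]] := smith_augmx A_ns.
set s := smith_orders G e.
have := dx_gt0; rewrite all_rcons => /andP[x_gt0 d_gt0].
have dec_Gamma : decomp Gamma (rcons d x).
  exact: decomp_isomorphic Gamma_d (decomp_dsum dx_gt0).
have dec_B : decomp (dsum d) d := decomp_dsum d_gt0.
have dec_S : decomp (Sred Gk) s := decomp_Sred smith Gk.
have s_gt0 : all (fun m => 0 < m)%N (rev s).
  by rewrite all_rev; exact: smith_orders_gt0 smith.
have s_desc : dvd_desc (rev s) := smith_orders_desc smith.
have dx_desc : dvd_desc (rev (rcons d x)) by rewrite /dvd_desc rev_sorted.
have d_desc : dvd_desc (rev d).
  by move: dx_desc; rewrite rev_rcons => /path_sorted.
have s0_desc : dvd_desc (0%N :: rev s).
  move: s_desc; rewrite /dvd_desc /=.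
  by case: (rev s) => //= y t ->; rewrite dvdn0.
have dx_gt0' : all (fun m => 0 < m)%N (rev (rcons d x)) by rewrite all_rev.
have d_gt0' : all (fun m => 0 < m)%N (rev d) by rewrite all_rev.
have embB : embeds (dsum d) (Sred Gk) <-> dvd_nth (rev d) (rev s).
  split; last first.
    exact: embeds_of_dvd_nth (decomp_rev dec_B) (decomp_rev dec_S) s_gt0.
  by apply: dvd_nth_of_embeds => //; exact: decomp_rev.
have embG : embeds Gamma (Sred Gk) <-> dvd_nth (rev (rcons d x)) (rev s).
  split; last first.
    exact: embeds_of_dvd_nth (decomp_rev dec_Gamma) (decomp_rev dec_S) s_gt0.
  by apply: dvd_nth_of_embeds => //; exact: decomp_rev.
have genE : (exists f : G -> Gamma, magic f /\ generating f) <->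
    dvd_nth (rev d) (rev s).
  (* In decreasing order the appended 0 comes first. It is paired with d_r, which divides it, and
     the remaining entries shift by one. *)
  have -> : dvd_nth (rev d) (rev s) <->
      dvd_nth (rev (rcons d x)) (rev (rcons s 0%N)).
    rewrite !rev_rcons; split=> [ds [|i]|ds i]; [exact: dvdn0|exact: ds|].
    exact: (ds i.+1).
  split=> [[f [f_magic f_gen]]|ds]; last first.
    have /gens_rev := gens_of_dvd_nth (decomp_rev dec_Gamma) ds.
    by rewrite revK; exact: (generating_of_gens smith).
  apply: (dvd_nth_of_gens (decomp_rev dec_Gamma)) => //.
    by rewrite rev_rcons.
  exact/gens_rev/(gens_of_generating smith f_magic).
have affE : (exists f : G -> Gamma, magic f /\ affinely_generating f) <->
    dvd_nth (rev (rcons d x)) (rev s).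
  split=> [[f [f_magic f_gen]]|ds]; last first.
    have /gens_rev := gens_of_dvd_nth (decomp_rev dec_Gamma) ds.
    by rewrite revK; exact: (affinely_generating_of_gens smith Gk).
  apply: (dvd_nth_of_gens (decomp_rev dec_Gamma)) => //.
  exact/gens_rev/(gens_of_affinely_generating smith Gk f_magic).
have card_Gamma : #|Gamma| = (\prod_(m <- d) m * x)%N.
  case: Gamma_d => phi /bij_eq_card ->; rewrite card_dsum //.
  by rewrite -cats1 big_cat big_seq1.
have absdetE : (absdet G %/ k)%N = (\prod_(m <- rev s) m)%N.
  rewrite (absdet_smith smith Gk) mulKn //.
  by rewrite (perm_big _ (permEl (perm_rev s))).
have aff_dvd : dvd_nth (rev (rcons d x)) (rev s) ->
    (x %| zexponent (Sred Gk))%N /\ (#|Gamma| %| absdet G %/ k)%N.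
  move=> ds; split.
    have := dvd_zexponent_of_embeds (size d) dec_Gamma (embG.2 ds).
    by rewrite nth_rcons ltnn eqxx.
  have := dvdn_prod_of_dvd_nth ds; rewrite absdetE card_Gamma rev_rcons.
  by rewrite big_cons (perm_big _ (permEl (perm_rev d))) mulnC.
split; last split.
- split=> [|r_ge2]; first by rewrite genE embB.
  move=> /genE ds; split.
    (* This index is that of d_(r-1), the last factor of B_Gamma, present because r >= 2. *)
    have := dvd_zexponent_of_embeds (size d).-1 dec_B (embB.2 ds).
    rewrite nth_rcons -[(size d).-1]subn1 ltn_subrL /= -ltnS r_ge2.
    by rewrite (set_nth_default 0%N) // subn1 prednK.
  rewrite card_Gamma mulnK // absdetE -(perm_big _ (permEl (perm_rev d))).
  exact: dvdn_prod_of_dvd_nth.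
- by split=> [|/affE]; [rewrite affE embG|exact: aff_dvd].
- move=> _ [f [f_magic [g fK gK]]].
  suff ds : dvd_nth (rev (rcons d x)) (rev s).
    by have [? ?] := aff_dvd ds; split=> //; apply/embG.
  (* A bijective f attains both h and 0, so every h is itself a difference of values. *)
  apply/affE; exists f; split=> //; apply/setP=> h; rewrite inE mem_gen //.
  by apply/imset2P; exists (g h) (g 0) => //; rewrite !gK subr0.
Qed.
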